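(* Let $A\in\mathbb{R}^{n\times n}$, $B\in\mathbb{R}^{n\times p}$, $C\in\mathbb{R}^{m\times n}$. Consider the control system $x'=Ax+Bu$ with the observation $y=Cx$. Assume that the pair $(A,C)$ is detectable and let $L\in\mathbb{R}^{n\times m}$ be a matrix such that $A+LC$ is stable. Then the system $$\hat x'=(A+LC)\hat x-Ly+Bu$$ defines a dynamical observer, i.e., $\hat x-x\to 0$ exponentially as $t\to+\infty$. Assume in addition that the pair $(A,B)$ is stabilizable and let $K\in\mathbb{R}^{p\times n}$ be a matrix such that $A+BK$ is stable. Then, for the control $u=K\hat x$, it holds that $x(t)\to 0$ exponentially as $t\to+\infty$.
   Context: A square matrix $M\in\mathbb{R}^{n\times n}$ is called stable if $e^{tM}x_0\to0$ as $t\to+\infty$ for all $x_0\in\mathbb{R}^n$. The pair $(A,C)$ is detectable if there exists $L\in\mathbb{R}^{n\times m}$ such that $A+LC$ is stable. The pair $(A,B)$ is stabilizable if there exists $K\in\mathbb{R}^{p\times n}$ such that $A+BK$ is stable. The initial data $x(0),\hat x(0)\in\mathbb{R}^n$ are arbitrary. *)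

(* Defs.v *)
From HB Require Import structures.
From mathcomp Require Import all_boot all_order all_algebra.
From mathcomp Require Import all_classical all_reals all_analysis.
Set Implicit Arguments.
Unset Strict Implicit.
Unset Printing Implicit Defensive.
Import Order.TTheory GRing.Theory Num.Theory.
Import numFieldNormedType.Exports.
Local Open Scope classical_set_scope.
Local Open Scope ring_scope.

Definition expmx (R : realType) (n : nat) (M : 'M[R]_n) : 'M[R]_n :=
  limn (series (fun k : nat => k`!%:R^-1 *: M ^+ k)).

Definition stable (R : realType) (n : nat) (M : 'M[R]_n) : Prop :=
  forall x0 : 'cV[R]_n, expmx (t *: M) *m x0 @[t --> +oo] --> (0 : 'cV[R]_n).

Definition detectable (R : realType) (n m : nat)
    (A : 'M[R]_n) (C : 'M[R]_(m, n)) : Prop :=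
  exists L : 'M[R]_(n, m), stable (A + L *m C).

Definition stabilizable (R : realType) (n p : nat)
    (A : 'M[R]_n) (B : 'M[R]_(n, p)) : Prop :=
  exists K : 'M[R]_(p, n), stable (A + B *m K).

Definition absolutely_continuous (R : realType) (V : normedModType R)
    (a b : R) (f : R -> V) : Prop :=
  forall e : R, 0 < e -> exists2 d : R, 0 < d &
    forall (k : nat) (s t : 'I_k -> R),
      (forall i, [/\ a <= s i, s i <= t i & t i <= b]) ->
      trivIset setT (fun i => `]s i, t i[%classic) ->
      \sum_(i < k) (t i - s i) < d ->
      \sum_(i < k) `|f (t i) - f (s i)| < e.

(* Solutions on [0, +oo[ of z' = f(t, z) in the sense of Caratheodory: the
   control entering f need not be continuous, so the equation is only required
   almost everywhere, of a locally absolutely continuous z.  The initial value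
   z 0 is free, and the values of z at negative times play no role. *)
Definition ode_solution (R : realType) (n : nat)
    (f : R -> 'cV[R]_n -> 'cV[R]_n) (z : R -> 'cV[R]_n) : Prop :=
  (forall T : R, 0 < T -> absolutely_continuous 0 T z) /\
  {ae @lebesgue_measure R, forall t : R, 0 < t -> is_derive t 1 z (f t (z t))}.

Definition control_system (R : realType) (n p : nat)
    (A : 'M[R]_n) (B : 'M[R]_(n, p))
    (u : R -> 'cV[R]_p) (x : R -> 'cV[R]_n) : Prop :=
  ode_solution (fun t z => A *m z + B *m u t) x.

Definition observer_system (R : realType) (n m p : nat)
    (A : 'M[R]_n) (B : 'M[R]_(n, p)) (C : 'M[R]_(m, n)) (L : 'M[R]_(n, m))
    (u : R -> 'cV[R]_p) (y : R -> 'cV[R]_m) (xhat : R -> 'cV[R]_n) : Prop :=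
  ode_solution (fun t z => (A + L *m C) *m z - L *m y t + B *m u t) xhat.

Definition cvg0_exponentially (R : realType) (V : normedModType R)
    (f : R -> V) : Prop :=
  exists c g : R, 0 < g /\
    forall t : R, 0 <= t -> `|f t| <= c * expR (- (g * t)).

Definition dynamical_observer (R : realType) (n m p : nat)
    (A : 'M[R]_n) (B : 'M[R]_(n, p)) (C : 'M[R]_(m, n))
    (L : 'M[R]_(n, m)) : Prop :=
  forall (u : R -> 'cV[R]_p) (x xhat : R -> 'cV[R]_n),
    control_system A B u x ->
    observer_system A B C L u (fun t => C *m x t) xhat ->
    cvg0_exponentially (fun t => xhat t - x t).

(* Main.v *)
(** Both error and state solve [z' = M z + h] with [M] stable and [h] decaying
    exponentially: for the error [xhat - x], [M = A + L C] and [h = 0]; for [x],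
    [M = A + B K] and [h = B K (xhat - x)].  A stable [M] has
    [|exp (t M)| <= c exp (- g t)], because some time [T] halves the norm and
    [exp] is a semigroup.  For fixed [t], the absolutely continuous function
    [w r = exp ((t - r) M) z r] has [w' r = exp ((t - r) M) h r] almost
    everywhere, and this is [O (exp (- g t))] uniformly in [0 < r < t].  Hence
    [|z t - exp (t M) z 0| = |w t - w 0| = O (t exp (- g t))], by the mean value
    inequality for absolutely continuous functions; no integral is needed. *)
Require Import Defs.
From mathcomp Require Import all_boot all_order all_algebra.
From mathcomp Require Import all_classical all_reals all_analysis.
From mathcomp Require Import ring lra.
Set Implicit Arguments.
Unset Strict Implicit.
Unset Printing Implicit Defensive.
Import Order.TTheory GRing.Theory Num.Theory.
Import numFieldNormedType.Exports.
Local Open Scope classical_set_scope.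
Local Open Scope ring_scope.

(** * Mean value inequality for absolutely continuous functions *)

Lemma trivIset_ordered_itv {R : realType} (k : nat) (s u : nat -> R) :
  (forall i j, (i < j < k)%N -> u i <= s j) ->
  trivIset setT (fun i : 'I_k => `]s i, u i[%classic).
Proof.
move=> us i j _ _ [x []] /=; rewrite !in_itv/= => /andP[si iu] /andP[sj ju].
apply: val_inj => /=; case: (ltngtP i j) => // ij.
- by have := us i j; rewrite ij ltn_ord leNgt (lt_trans sj iu) => /(_ isT).
- by have := us j i; rewrite ij ltn_ord leNgt (lt_trans si ju) => /(_ isT).
Qed.

(** Additivity over the disjoint intervals and monotonicity. It turns a small measure of [O] into
    the bound on total length that absolute continuity asks for. *)
Lemma sum_length_le_measure {R : realType} (O : set R) (k : nat)
    (s u : nat -> R) :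
  measurable O ->
  (forall i, (i < k)%N -> s i <= u i) ->
  (forall i, (i < k)%N -> `]s i, u i[ `<=` O) ->
  (forall i j, (i < j < k)%N -> u i <= s j) ->
  ((\sum_(i < k) (u i - s i))%:E <= @lebesgue_measure R O)%E.
Proof.
move=> mO su suO /trivIset_ordered_itv tI.
have -> : ((\sum_(i < k) (u i - s i))%:E =
    @lebesgue_measure R (\big[setU/set0]_(i < k) `]s i, u i[%classic))%E.
  rewrite measure_bigsetU_ord// -sumEFin; apply: eq_bigr => i _.
  apply: (etrans _ (esym (lebesgue_measure_itv _))) => /=; rewrite lte_fin.
  by case: ltgtP (su i (ltn_ord i)) => // -> _; rewrite subrr.
apply: le_measure; rewrite ?inE//; first exact: bigsetU_measurable.
rewrite -(bigcup_mkord k (fun i => `]s i, u i[%classic)).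
by move=> x [i /= ik]; exact: suO.
Qed.

Section absolutely_continuous_increment.
Context {R : realType} (f : R -> R) (a b : R).

(* [C] bounds the growth of [f] off [O], and the finitely many intervals
   [`]s i, u i[] inside [O] account for the rest. *)
Definition increment_covered (O : set R) (C t : R) : Prop :=
  exists (k : nat) (s u : nat -> R),
  [/\ forall i, (i < k)%N -> [/\ a <= s i, s i <= u i & u i <= t],
      forall i, (i < k)%N -> `]s i, u i[ `<=` O,
      forall i j, (i < j < k)%N -> u i <= s j &
      `|f t - f a| <= C * (t - a) + \sum_(i < k) `|f (u i) - f (s i)|].

(** The increment over []t, t'[] is either absorbed by the slope term or paid for by appending []t,
    t'[] as a last interval, to the right of all earlier ones. *)
Lemma increment_covered_step (O : set R) (C t t' : R) : 0 <= C ->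
  a <= t -> t <= t' -> increment_covered O C t ->
  `|f t' - f t| <= C * (t' - t) \/ `]t, t'[ `<=` O ->
  increment_covered O C t'.
Proof.
move=> C0 at' tt' [k [s [u [h1 h2 h3 h4]]]].
have tri : `|f t' - f a| <= `|f t' - f t| + `|f t - f a|.
  by rewrite (le_trans _ (ler_normD _ _))// addrA subrK.
case=> [good|bad].
  exists k, s, u; split => //.
    by move=> i /h1[? ? /le_trans]; split => //; auto.
  lra.
exists k.+1, (fun i => if i == k then t else s i),
  (fun i => if i == k then t' else u i); split.
- move=> i; rewrite ltnS leq_eqVlt; case: eqP => //= _ /h1[? ? /le_trans].
  by split => //; auto.
- by move=> i; rewrite ltnS leq_eqVlt; case: eqP => //= _ /h2.
- move=> i j /andP[ij]; rewrite ltnS leq_eqVlt => jk.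
  have ik : (i < k)%N by case/orP: jk => [/eqP <-//|]; exact: ltn_trans.
  rewrite (ltn_eqF ik); case: eqP jk => [_ _|_ /= jk].
    by have [] := h1 _ ik.
  by apply: h3; rewrite ij.
- rewrite big_ord_recr/= eqxx.
  under eq_bigr do rewrite (ltn_eqF (ltn_ord _)).
  have : C * (t - a) <= C * (t' - a) by apply: ler_wpM2l => //; lra.
  lra.
Qed.

(* A supremum argument in the manner of Cousin's lemma. *)
Lemma increment_covered_itv (O : set R) (C : R) : a <= b -> 0 <= C ->
  (forall c, a <= c <= b -> exists2 d : R, 0 < d &
    forall t t', c - d < t -> t <= c -> c <= t' -> t' < c + d ->
    a <= t -> t' <= b ->
    `|f t' - f t| <= C * (t' - t) \/ `]t, t'[ `<=` O) ->
  increment_covered O C b.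
Proof.
move=> ab C0 loc.
pose S := [set t | a <= t <= b /\ increment_covered O C t].
have Sa : S a.
  split; first by rewrite lexx ab.
  exists 0%N, (fun=> 0), (fun=> 0); split => //.
  by rewrite big_ord0 !subrr normr0 mulr0 addr0.
have Sub : ubound S b by move=> t [/andP[]].
have Ssup : has_sup S by split; [exists a|exists b].
have ac : a <= sup S by apply: ub_le_sup Sa; exists b.
have cb : sup S <= b by apply: ge_sup => //; exists a.
have [d d0 hd] := loc (sup S) (introT andP (conj ac cb)).
have [t [/andP[at' tb] Pt] tc] := sup_adherent d0 Ssup.
have tS : t <= sup S by apply: ub_le_sup; [exists b|split=> //; rewrite at'].
(* [t'] passes [sup S] by [d / 2] unless [b] cuts it off; since [t'] will lie in [S], only [t' = b]
   is possible. *)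
pose t' := Num.min b (sup S + d / 2).
have ct' : sup S <= t' by rewrite le_min cb lerDl ltW// divr_gt0.
have t'b : t' <= b by rewrite ge_min lexx.
have t'd : t' < sup S + d.
  by rewrite gt_min ltrD2l ltr_pdivrMr// ltr_pMr// ltr1n orbT.
have Pt' : increment_covered O C t'.
  by apply: increment_covered_step (hd _ _ tc tS ct' t'd at' t'b) => //; lra.
have : t' <= sup S.
  by apply: ub_le_sup; [exists b|split => //; rewrite t'b andbT (le_trans ac)].
move: Pt'; rewrite /t' /Num.min; case: ltP => // bS _ h; lra.
Qed.

End absolutely_continuous_increment.

(** Near [c] the difference quotient is within [e] of [df]. Increments are controlled only from the
    centre [c], which is why the covering argument works with [t <= c <= t']. *)
Lemma is_derive_local_lipschitz {R : realType} (f : R -> R) (c df e : R) :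
  is_derive c 1 f df -> 0 < e -> exists2 r : R, 0 < r &
  forall t, `|t - c| < r -> `|f t - f c| <= (`|df| + e) * `|t - c|.
Proof.
move=> [+ +] e0; rewrite /derivable /derive => /[swap] -> /cvgrPdist_le.
move=> /(_ _ e0)[r /= r0 hr]; exists r => // t tr.
have [->|tc] := eqVneq t c; first by rewrite !subrr normr0 mulr0.
have tc0 : t - c != 0 by rewrite subr_eq0.
have := hr (t - c); rewrite /ball_/= sub0r normrN => /(_ tr tc0).
rewrite -[_ *: 1]/(_ * 1) mulr1 subrK => hd.
have -> : f t - f c = (t - c) * ((t - c)^-1 * (f t - f c)) by rewrite mulVKf.
rewrite normrM mulrC ler_wpM2r//.
have := ler_normB df (df - (t - c)^-1 *: (f t - f c)).
rewrite opprB addrC subrK; move/le_trans; apply.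
by rewrite lerD2l.
Qed.

(** The exceptional null set is enclosed in an open [O] of measure below [d]. Off [O] the derivative
    bounds the growth with slope just above [C]; inside [O] absolute continuity bounds the total
    increment. *)
Lemma absolutely_continuous_le {R : realType} (f : R -> R) (a b C : R) :
  a <= b -> 0 <= C -> absolutely_continuous a b f ->
  {ae @lebesgue_measure R, forall t, a < t < b ->
     exists2 df, is_derive t 1 f df & `|df| <= C} ->
  `|f b - f a| <= C * (b - a).
Proof.
move=> ab C0 acf [N [mN N0 sN]].
apply/ler_addgt0Pr => e e0.
(* The excess slope then costs [e' * (b - a) <= e / 2]; the [+ 1] keeps the denominator positive
   when [a = b]. *)
have e1 : 0 < e / 2 / (b - a + 1) by rewrite !divr_gt0//; lra.
set e' := e / 2 / (b - a + 1) in e1.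
have [d d0 acd] := acf _ (divr_gt0 e0 (ltr0Sn R 1)).
(* The endpoints join the null set because the derivative is bounded only strictly between them. *)
have mN' : measurable (N `|` [set a] `|` [set b]).
  by do 2 apply: measurableU => //.
have N'0 : lebesgue_measure (N `|` [set a] `|` [set b]) = 0%E.
  apply/negligibleP => //; apply: negligibleU; first apply: negligibleU.
  - exact/negligibleP.
  - by apply/negligibleP => //; exact: lebesgue_measure_set1.
  - by apply/negligibleP => //; exact: lebesgue_measure_set1.
have [ O [oO sO] muO] : exists2 O : set R,
    open O /\ N `|` [set a] `|` [set b] `<=` O &
    (lebesgue_measure O < d%:E)%E.
  have [|O [oO sO mO]] := lebesgue_regularity_outer mN' _ d0.
    by have := ltry (0 : R); rewrite -[0%:E]N'0.
  (* Outer regularity bounds the measure of [O] minus the null set, and the null set adds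
     nothing. *)
  exists O => //; apply: le_lt_trans mO.
  have mO := measurable_realfun.open_measurable oO.
  rewrite -[X in (_ X <= _)%E](setDUK sO).
  apply: (le_trans (measureU2 _ _ _)) => //; first exact: measurableD.
  by rewrite [X in (X + _)%E](N'0 : _ = 0%E) add0e.
have [| |k [s [u [h1 h2 h3 h4]]]] :=
    @increment_covered_itv _ f a b O (C + e') ab.
- lra.
- move=> c /andP[ac cb].
  have [cO|ncO] := pselect (O c).
    move/nbhs_ballP: (oO c cO) => [r /= r0 rO]; exists r => //.
    move=> t t' ct tc ct' t'c _ _; right => x /=.
    rewrite in_itv/= => /andP[tx xt].
    by apply: rO; rewrite /ball/= ltr_distlC; apply/andP; split; lra.
  have [df fdf dfC] : exists2 df, is_derive c 1 f df & `|df| <= C.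
    apply: contrapT => nd; apply: ncO; apply: sO.
    have [->|ca] := eqVneq c a; first by left; right.
    have [->|cb'] := eqVneq c b; first by right.
    left; left; apply: sN => /= h; apply: nd; apply: h.
    by rewrite !lt_neqAle eq_sym ca ac cb' cb.
  (* As [t <= c <= t'], the bounds on both sides of [c] add up to [l * (t' - t)]. *)
  pose l := `|df| + e'.
  have [r /= r0 hr] := is_derive_local_lipschitz fdf e1.
  exists r => // t t' ct tc ct' t'c _ _; left.
  have h1 : `|f t - f c| <= l * `|t - c|.
    by apply: hr; rewrite ltr_norml; apply/andP; split; lra.
  have h2 : `|f t' - f c| <= l * `|t' - c|.
    by apply: hr; rewrite ltr_norml; apply/andP; split; lra.
  rewrite [`|t - c|]ler0_norm ?subr_le0// in h1.
  rewrite [`|t' - c|]ger0_norm ?subr_ge0// in h2.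
  have : `|f t' - f t| <= `|f t' - f c| + `|f t - f c|.
    have -> : f t' - f t = (f t' - f c) - (f t - f c) by ring.
    exact: ler_normB.
  have : l * (t' - t) <= (C + e') * (t' - t).
    by apply: ler_wpM2r; rewrite ?/l; lra.
  lra.
have sumd : \sum_(i < k) (u i - s i) < d.
  rewrite -lte_fin; apply: le_lt_trans muO.
  apply: sum_length_le_measure => //.
    exact: measurable_realfun.open_measurable.
  by move=> i /h1[].
have := acd k (fun i => s i) (fun i => u i) _ (trivIset_ordered_itv h3) sumd.
have hsu (i : 'I_k) : [/\ a <= s i, s i <= u i & u i <= b] by exact: h1.
move=> /(_ hsu).
have : e' * (b - a) <= e / 2.
  by rewrite /e' mulrAC ler_pdivrMr ?ler_pM2l; lra.
lra.
Qed.

(** * Entrywise convergence and bounds for matrices *)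

Lemma cvg_mx {R : realType} {T : Type} {F : set_system T} {FF : Filter F}
    (m n : nat) (u : T -> 'M[R]_(m, n)) (l : 'M[R]_(m, n)) :
  (forall i j, u x i j @[x --> F] --> l i j) -> u x @[x --> F] --> l.
Proof.
move=> ul; apply/cvgrPdist_le => /= e e0; near=> x.
rewrite /Num.Def.normr/= mx_normrE (bigmax_le _ (ltW e0))//= => i _.
rewrite !mxE/=.
move: i; near: x; apply: filter_forall => /= i.
exact: ((cvgrPdist_le _ _).1 (ul i.1 i.2)).
Unshelve. all: by end_near. Qed.

Section mx_norm_bounds.
Context {R : realType}.

Lemma mx_norm_entry (m n : nat) (M : 'M[R]_(m, n)) i j : `|M i j| <= `|M|.
Proof.
rewrite [leRHS]/Num.Def.normr/= mx_normrE.
exact: (le_bigmax _ (fun ij => `|M ij.1 ij.2|) (i, j)).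
Qed.

Lemma mx_norm_le (m n : nat) (M : 'M[R]_(m, n)) (c : R) : 0 <= c ->
  (forall i j, `|M i j| <= c) -> `|M| <= c.
Proof.
by move=> c0 h; rewrite /Num.Def.normr/= mx_normrE (bigmax_le _ c0)//= => i _.
Qed.

(** The norm is the largest modulus of an entry, so each product costs a factor [n]. Bounding one
    column of [N] by [c] serves both the norm inequality and the induction on powers. *)
Lemma mulmx_entry_le (m n p : nat) (M : 'M[R]_(m, n)) (N : 'M[R]_(n, p)) c i j :
  (forall k, `|N k j| <= c) -> `|(M *m N) i j| <= n%:R * `|M| * c.
Proof.
move=> h; rewrite mxE (le_trans (ler_norm_sum _ _ _))//.
rewrite -mulrA mulr_natl -[X in _ *+ X]card_ord -sumr_const ler_sum// => k _.
by rewrite normrM ler_pM// mx_norm_entry.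
Qed.

Lemma mx_norm_mul (m n p : nat) (M : 'M[R]_(m, n)) (N : 'M[R]_(n, p)) :
  `|M *m N| <= n%:R * `|M| * `|N|.
Proof.
apply: mx_norm_le => [|i j]; first by rewrite !mulr_ge0.
by apply: mulmx_entry_le => k; exact: mx_norm_entry.
Qed.

Lemma mx_pow_entry (n : nat) (M : 'M[R]_n) k i j :
  `|(M ^+ k) i j| <= (n%:R * `|M|) ^+ k.
Proof.
elim: k i j => [|k IH] i j.
  by rewrite !expr0 mxE; case: (i == j); rewrite /= ?normr1 ?normr0.
by rewrite !exprS; apply: mulmx_entry_le => l; exact: IH.
Qed.

Lemma scalemx_pow (n : nat) (t : R) (M : 'M[R]_n) k :
  (t *: M) ^+ k = t ^+ k *: M ^+ k.
Proof.
elim: k => [|k IH]; first by rewrite !expr0 scale1r.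
by rewrite !exprS IH -!mulmxE -scalemxAl -scalemxAr scalerA.
Qed.

End mx_norm_bounds.

(** Comparison with [b] times the exponential series at [c * |x|]. *)
Lemma is_cvg_exp_dominated {R : realType} (a : nat -> R) (b c x : R) :
  0 <= c -> (forall k, `|a k| <= b * c ^+ k) ->
  cvgn (pseries (fun k => k`!%:R^-1 * a k) x).
Proof.
move=> c0 ab; apply: normed_cvg.
have b0 : 0 <= b by have := ab 0%N; rewrite expr0 mulr1; exact: le_trans.
apply: (@series_le_cvg _ _ (fun k => b * exp_coeff (c * `|x|) k)).
- by move=> k /=.
- by move=> k /=; rewrite mulr_ge0// exp_coeff_ge0// mulr_ge0.
- move=> k /=; rewrite /exp_coeff/= !normrM normrX exprMn.
  rewrite [`|_^-1|]ger0_norm ?invr_ge0//.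
  rewrite (_ : b * _ = k`!%:R^-1 * (b * c ^+ k) * `|x| ^+ k); last by ring.
  by rewrite ler_wpM2r// ?exprn_ge0// ler_wpM2l// invr_ge0.
- exact: (is_cvg_seriesZ (k := b) (is_cvg_series_exp_coeff (c * `|x|))).
Qed.

(** * The matrix exponential as an entrywise power series *)

Section expmx_theory.
Context {R : realType} (n : nat) (M : 'M[R]_n).

Local Notation E t := (expmx (t *: M)).

(** Coefficients of the power series in [t] of an entry of [M ^+ p *m E t], the [p]-th derivative of
    [E t]; termwise differentiation raises [p] by one. *)
Let coef p i j k : R := k`!%:R^-1 * (M ^+ (k + p)) i j.

Let pseries_diffs_coef p i j : pseries_diffs (coef p i j) = coef p.+1 i j.
Proof.
apply/funext => k.
by rewrite /pseries_diffs /coef factS natrM invfM addSnnS mulrA mulVKf.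
Qed.

Let is_cvg_coef p i j x : cvgn (pseries (coef p i j) x).
Proof.
apply: (@is_cvg_exp_dominated _ _ ((n%:R * `|M|) ^+ p) (n%:R * `|M|)).
  by rewrite mulr_ge0.
by move=> k; rewrite -exprD addnC; exact: mx_pow_entry.
Qed.

Let expmx_entry t i j : E t i j = limn (pseries (coef 0 i j) t).
Proof.
have h : series (fun k => k`!%:R^-1 *: (t *: M) ^+ k) @ \oo -->
    (\matrix_(i, j) limn (pseries (coef 0 i j) t) : 'M[R]_n).
  apply: cvg_mx => i' j'; rewrite mxE.
  suff -> : (fun k => series (fun k => k`!%:R^-1 *: (t *: M) ^+ k) k i' j') =
      pseries (coef 0 i' j') t by exact: is_cvg_coef.
  apply/funext => k; rewrite /series /pseries/= summxE.
  apply: eq_bigr => l _.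
  by rewrite scalemx_pow !mxE /coef addn0 mulrA mulrAC.
by rewrite /expmx (cvg_lim _ h)// mxE.
Qed.

(** Here [M ^+ k.+1] is split with [M] on the left, in [expmx_entryMr] with [M] on the right;
    reaching the same series makes [M] and [E t] commute. *)
Let expmx_entryMl t i j : (M *m E t) i j = limn (pseries (coef 1 i j) t).
Proof.
rewrite mxE; apply/esym/cvg_lim => //.
under eq_bigr do rewrite expmx_entry.
rewrite (_ : pseries _ _ =
    fun k => \sum_l M i l * pseries (coef 0 l j) t k); last first.
  apply/funext => k; rewrite /pseries/= /series/=.
  under [RHS]eq_bigr do rewrite mulr_sumr.
  rewrite exchange_big/=; apply: eq_bigr => l _.
  rewrite /coef addn1 exprS mxE mulr_sumr mulr_suml.
  by apply: eq_bigr => q _; rewrite addn0; ring.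
apply: (cvg_big (@add_continuous R)) => l _; apply: cvgMl_tmp.
exact: is_cvg_coef.
Qed.

Let expmx_entryMr t i j : (E t *m M) i j = limn (pseries (coef 1 i j) t).
Proof.
rewrite mxE; apply/esym/cvg_lim => //.
under eq_bigr do rewrite expmx_entry.
rewrite (_ : pseries _ _ =
    fun k => \sum_l pseries (coef 0 i l) t k * M l j); last first.
  apply/funext => k; rewrite /pseries/= /series/=.
  under [RHS]eq_bigr do rewrite mulr_suml.
  rewrite exchange_big/=; apply: eq_bigr => l _.
  rewrite /coef addn1 exprSr mxE mulr_sumr mulr_suml.
  by apply: eq_bigr => q _; rewrite addn0; ring.
apply: (cvg_big (@add_continuous R)) => l _; apply: cvgMr_tmp.
exact: is_cvg_coef.
Qed.

Lemma expmx_comm t : M *m E t = E t *m M.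
Proof. by apply/matrixP => i j; rewrite expmx_entryMl expmx_entryMr. Qed.

Lemma is_derive_expmx t i j :
  is_derive t (1 : R) (fun t => E t i j) ((M *m E t) i j).
Proof.
under [X in is_derive _ _ X _]funext do rewrite expmx_entry.
rewrite expmx_entryMl -pseries_diffs_coef.
(* The series converge everywhere, so any number above [|t|] would do. *)
apply: (@pseries_snd_diffs _ _ (`|t| + 1)); rewrite ?pseries_diffs_coef.
- exact: is_cvg_coef.
- exact: is_cvg_coef.
- exact: is_cvg_coef.
- by rewrite [ltRHS]ger0_norm// ltrDl.
Qed.

Lemma expmx0 : E 0 = 1%:M.
Proof.
apply/matrixP => i j; rewrite expmx_entry; apply/cvg_lim => //.
(* The empty partial sum is 0 and all later ones equal the constant term; hence the shift by one. *)
rewrite -cvg_shiftS; apply: cvg_near_cst; apply: nearW => k /=.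
rewrite /pseries/= /series/= big_nat_recl// big1 => [|l _].
  by rewrite /coef expr0 fact0 invr1 mul1r mulr1 addr0.
by rewrite expr0n mulr0.
Qed.

(* The variation-of-constants formula in differential form. *)
Lemma is_derive_expmx_mul (q : nat) (T r : R) (v : R -> 'M[R]_(n, q))
    (h : 'M[R]_(n, q)) i k :
  (forall l, is_derive r (1 : R) (fun r => v r l k) ((M *m v r + h) l k)) ->
  is_derive r (1 : R) (fun r => (E (T - r) *m v r) i k) ((E (T - r) *m h) i k).
Proof.
move=> dv.
(* With [M] on the right of [E (T - r)], this term will cancel [E (T - r) *m M *m v r] coming from
   the derivative of [v]. *)
have dE l : is_derive r (1 : R) (fun r => E (T - r) i l)
    (- (E (T - r) *m M) i l).
  rewrite -expmx_comm.
  have dT : is_derive r (1 : R) (fun r => T - r) (-1).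
    rewrite -(sub0r 1).
    exact: is_deriveB (is_derive_cst T r 1) (is_derive_id r 1).
  have := @is_derive1_comp _ (fun t => E t i l) _ r _ _
    (is_derive_expmx (T - r) i l) dT.
  by rewrite mulrN1.
have -> : (fun r => (E (T - r) *m v r) i k) =
    \sum_(l < n) ((fun r => E (T - r) i l) * (fun r => v r l k)).
  by apply/funext => s; rewrite mxE fct_sumE.
have dEv := is_derive_sum (fun l => is_deriveM (dE l) (dv l)).
apply: (is_derive_eq dEv).
pose F := E (T - r).
transitivity ((F *m (M *m v r + h)) i k - (F *m M *m v r) i k).
  rewrite [in RHS]mxE [X in _ = _ - X]mxE -sumrB; apply: eq_bigr => l _ /=.
  by rewrite /GRing.scale/= mulrN [v r l k * _]mulrC.
by rewrite mulmxDr mulmxA mxE addrAC subrr add0r.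
Qed.

End expmx_theory.

(** * Bounds and closure properties of absolute continuity *)

Lemma absolutely_continuous_modulus {R : realType} {V : normedModType R}
    (a b e : R) (f : R -> V) : absolutely_continuous a b f -> 0 < e ->
  exists2 d : R, 0 < d &
    forall s t, a <= s -> s <= t -> t <= b -> t - s < d -> `|f t - f s| < e.
Proof.
move=> acf /acf[d d0 hd]; exists d => // s t as_ st tb std.
have := hd 1%N (fun=> s) (fun=> t); rewrite !big_ord1; apply=> //.
by move=> i j _ _ _; rewrite [i]ord1 [j]ord1.
Qed.

(** Walk from [a] in steps of at most [d / 2]: each changes [f] by less than 1, and finitely many
    reach [b]. *)
Lemma absolutely_continuous_bounded {R : realType} {V : normedModType R}
    (a b : R) (f : R -> V) : absolutely_continuous a b f ->
  exists2 K : R, 0 <= K & forall t, a <= t <= b -> `|f t| <= K.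
Proof.
move=> /absolutely_continuous_modulus /(_ ltr01)[d d0 hd].
have d20 : 0 < d / 2 by rewrite divr_gt0.
have step k t : a <= t <= b -> t <= a + d / 2 * k%:R -> `|f t| <= `|f a| + k%:R.
  elim: k t => [|k IH] t /andP[at_ tb] tk.
    have -> : t = a by apply/eqP; rewrite eq_le at_ (le_trans tk)// mulr0 addr0.
    by rewrite addr0.
  (* The maximum keeps the backward step inside the interval. *)
  pose s := Num.max a (t - d / 2).
  have st : s <= t by rewrite ge_max at_ gerBl ltW.
  have as_ : a <= s by rewrite le_max lexx.
  have sd : t - s < d.
    have : t - d / 2 <= s by rewrite le_max lexx orbT.
    lra.
  have fs : `|f s| <= `|f a| + k%:R.
    apply: IH; first by rewrite as_ (le_trans st).
    rewrite ge_max lerDl mulr_ge0 ?(ltW d20)//=.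
    by move: tk; rewrite -[k.+1%:R]natr1 mulrDr mulr1; lra.
  have := hd s t as_ st tb sd; have := ler_normD (f t - f s) (f s).
  by rewrite subrK -[k.+1%:R]natr1; lra.
pose k := (Num.bound ((b - a) / (d / 2))).
exists (`|f a| + k%:R) => [|t atb]; first by rewrite addr_ge0.
apply: step => //; have /andP[at_ tb] := atb.
have : (b - a) / (d / 2) < k%:R.
  by apply: archi_boundP; rewrite divr_ge0 ?(ltW d20)// subr_ge0 (le_trans at_).
by rewrite ltr_pdivrMr// mulrC; lra.
Qed.

(** One criterion for Lipschitz functions, for differences, and for products of bounded factors. *)
Lemma absolutely_continuous_dominated {R : realType}
    {U V W : normedModType R} (a b K : R) (f : R -> U) (g : R -> V)
    (h : R -> W) : 0 <= K ->
  absolutely_continuous a b f -> absolutely_continuous a b g ->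
  (forall s t, a <= s -> s <= t -> t <= b ->
    `|h t - h s| <= K * (`|f t - f s| + `|g t - g s|)) ->
  absolutely_continuous a b h.
Proof.
move=> K0 acf acg hfg e e0.
(* Each sum gets half of [e / (K + 1)]; the [+ 1] covers [K = 0]. *)
have e'0 : 0 < e / (2 * (K + 1)) by rewrite divr_gt0// mulr_gt0//; lra.
have [d1 d10 h1] := acf _ e'0; have [d2 d20 h2] := acg _ e'0.
exists (Num.min d1 d2); first by rewrite lt_min d10.
move=> k s t st tI; rewrite lt_min => /andP[l1 l2].
have {}h1 := h1 k s t st tI l1; have {}h2 := h2 k s t st tI l2.
apply: (@le_lt_trans _ _
    (K * (\sum_(i < k) `|f (t i) - f (s i)| +
          \sum_(i < k) `|g (t i) - g (s i)|))).
  rewrite -big_split mulr_sumr; apply: ler_sum => i _.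
  by have [? ? ?] := st i; exact: hfg.
apply: (@le_lt_trans _ _ (K * (e / (K + 1)))).
  apply: ler_wpM2l => //; apply: ltW; apply: lt_le_trans (ltrD h1 h2) _.
  have K1 : K + 1 != 0 by rewrite gt_eqF//; lra.
  by rewrite le_eqVlt; apply/orP; left; apply/eqP; field.
by rewrite mulrA ltr_pdivrMr ?mulrDr; lra.
Qed.

Lemma lipschitz_absolutely_continuous {R : realType} {V : normedModType R}
    (a b K : R) (f : R -> V) : 0 <= K ->
  (forall s t, a <= s -> s <= t -> t <= b -> `|f t - f s| <= K * (t - s)) ->
  absolutely_continuous a b f.
Proof.
move=> K0 lip.
have acid : absolutely_continuous a b (id : R -> R).
  move=> e e0; exists e => // k s t st _; apply: le_lt_trans.
  by apply: ler_sum => i _; have [_ ? _] := st i; rewrite ger0_norm ?subr_ge0.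
apply: (absolutely_continuous_dominated K0 acid acid) => s t as_ st tb.
apply: le_trans (lip s t as_ st tb) _; rewrite ler_wpM2l//.
by rewrite ger0_norm ?subr_ge0// lerDl subr_ge0.
Qed.

Lemma is_derive_entry {R : realType} (m n : nat) (z : R -> 'M[R]_(m, n))
    (t : R) (d : 'M[R]_(m, n)) i j :
  is_derive t (1 : R) z d -> is_derive t (1 : R) (fun r => z r i j) (d i j).
Proof.
move=> [dz <-]; apply: DeriveDef; first by move/derivable_mxP : dz; exact.
by rewrite derive_mx// mxE.
Qed.

(** * Semigroup property and exponential decay of the flow *)

Section expmx_flow.
Context {R : realType} (n : nat) (M : 'M[R]_n).

Local Notation E t := (expmx (t *: M)).

(** [E (s + t - r) *m E r] is constant in [r], by variation of constants with zero perturbation;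
    compare [r = 0] with [r = t]. *)
Lemma expmxD s t : E (s + t) = E s *m E t.
Proof.
apply/matrixP => i k.
have := @is_derive_0_is_cst _ (fun r => (E (s + t - r) *m E r) i k) 0 t.
rewrite subr0 addrK expmx0 mulmx1; apply=> r.
have := @is_derive_expmx_mul _ _ M n (s + t) r (fun t => E t) 0 i k.
by rewrite mulmx0 mxE; apply=> l; rewrite addr0; exact: is_derive_expmx.
Qed.

Lemma continuous_expmx : continuous (fun t : R => E t).
Proof.
move=> t; apply: cvg_mx => i j.
have := is_derive_expmx M t i j => -[dE _].
exact/differentiable_continuous/derivable1_diffP.
Qed.

Lemma expmx_bounded T : exists2 K : R, 0 <= K &
  forall t, 0 <= t <= T -> `|E t| <= K.
Proof.
have [T0|T0] := leP 0 T; last first.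
  by exists 0 => // t /andP[t0 tT]; have := lt_le_trans T0 t0; rewrite ltNge tT.
have cE : {within `[0, T], continuous (fun t => `|E t|)}.
  apply: continuous_subspaceT => t.
  by apply: cvg_norm; exact: continuous_expmx.
have [c _ hc] := EVT_max T0 cE.
by exists `|E c| => // t tT; apply: hc; rewrite in_itv.
Qed.

Lemma expmx_lipschitz T : exists2 K : R, 0 <= K &
  forall s t, 0 <= s -> s <= t -> t <= T -> `|E t - E s| <= K * (t - s).
Proof.
have [K K0 hK] := expmx_bounded T.
have K'0 : 0 <= n%:R * `|M| * K by rewrite !mulr_ge0.
exists (n%:R * `|M| * K) => // s t s0 st tT.
apply: mx_norm_le => [|i j]; first by rewrite mulr_ge0// subr_ge0.
have cE : {within `[s, t], continuous (fun t => E t i j)}.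
  apply: continuous_subspaceT => r.
  have := is_derive_expmx M r i j => -[dE _].
  exact/differentiable_continuous/derivable1_diffP.
have [c] := MVT_segment st (fun r _ => is_derive_expmx M r i j) cE.
rewrite in_itv/= => /andP[sc ct] Ets; rewrite !mxE Ets.
rewrite normrM [`|t - s|]ger0_norm ?subr_ge0// ler_wpM2r ?subr_ge0//.
apply: mulmx_entry_le => l; apply: le_trans (mx_norm_entry _ _ _) _.
by apply: hK; rewrite (le_trans s0 sc) (le_trans ct).
Qed.

(** Stability applied to the basis vectors gives the columns of [E t]. *)
Lemma stable_expmx_cvg0 : stable M -> E t @[t --> +oo] --> (0 : 'M[R]_n).
Proof.
move=> sM; apply: cvg_mx => i j; rewrite mxE.
have := sM (delta_mx j 0) => h.
have := cvg_comp _ _ h (@coord_continuous _ _ _ i 0 0).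
rewrite mxE; apply: cvg_trans; apply: near_eq_cvg; apply: nearW => t /=.
rewrite mxE (bigD1 j)//= big1 => [|k kj]; last by rewrite mxE (negbTE kj) mulr0.
by rewrite mxE !eqxx mulr1 addr0.
Qed.

Lemma stable_expmx_decay : stable M -> exists c g : R, 0 < g /\
  forall t, 0 <= t -> `|E t| <= c * expR (- (g * t)).
Proof.
move=> /stable_expmx_cvg0/cvgrPdist_lt Ecvg.
(* This threshold yields [n * |E T| <= 1 / 2], absorbing the factor [n] of [mx_norm_mul]; [n.+1]
   keeps it positive when [n = 0]. *)
have e0 : 0 < (2 * n.+1%:R)^-1 :> R by rewrite invr_gt0 mulr_gt0.
have [T T0 hT] : exists2 T : R, 0 < T & n%:R * `|E T| <= 2^-1.
  near (pinfty_nbhs R) => T; exists T; first by near: T; exact: nbhs_pinfty_gt.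
  have : `|0 - E T| < (2 * n.+1%:R)^-1 by near: T; exact: Ecvg.
  rewrite sub0r normrN invfM => /ltW h.
  apply: (@le_trans _ _ (n.+1%:R * (2^-1 / n.+1%:R))).
    by rewrite ler_pM// ler_nat.
  by rewrite mulrCA mulfV// mulr1.
have [K K0 hK] := expmx_bounded T.
(* The rate at which one period [T] contributes a factor of exactly one half. *)
pose g := ln 2 / T.
have g0 : 0 < g by rewrite divr_gt0// ln_gt0// ltr1n.
have gT : expR (g * T) = 2 by rewrite divfK ?gt_eqF// lnK// posrE.
(* On [[0, T]] the exponential is at least one half, so [2 * K] suffices there; the induction then
   removes one period [T] at a time. *)
exists (2 * K), g; split=> // t t0.
have step k s : 0 <= s <= T * k.+1%:R -> `|E s| <= 2 * K * expR (- (g * s)).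
  elim: k s => [|k IH] s /andP[s0 sk].
    rewrite mulr1 in sk; apply: le_trans (hK s _) _; first by rewrite s0.
    rewrite expRN ler_pdivlMr ?expR_gt0// mulrC ler_wpM2r//.
    by rewrite -gT ler_expR ler_wpM2l// ltW.
  have [sT|Ts] := leP s T.
    by apply: IH; rewrite s0 (le_trans sT)// ler_peMr ?(ltW T0)// ler1n.
  have := expmxD T (s - T); rewrite subrKC => ->.
  apply: le_trans (mx_norm_mul _ _) _.
  have {}IH : `|E (s - T)| <= 2 * K * expR (- (g * (s - T))).
    apply: IH; rewrite subr_ge0 ltW//= lerBlDr.
    by move: sk; rewrite -[k.+2%:R]natr1 mulrDr mulr1.
  apply: le_trans (ler_pM _ _ hT IH) _ => //.
  rewrite mulrBr opprB expRD gT.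
  by rewrite le_eqVlt; apply/orP; left; apply/eqP; field.
apply: (step (Num.bound (t / T))).
rewrite t0/= mulrC -ler_pdivrMr// ltW//.
have tT0 : 0 <= t / T by rewrite divr_ge0// ltW.
by apply: lt_trans (archi_boundP tT0) _; rewrite ltr_nat.
Unshelve. all: by end_near. Qed.

End expmx_flow.

(** * Linear equations with a decaying perturbation, and the observer *)

Lemma ae_lebesgue_filter (R : realType) :
  Filter (almost_everywhere (@lebesgue_measure R)).
Proof. exact: ae_filter_ringOfSetsType. Qed.

(** A product of a Lipschitz and an absolutely continuous factor, both bounded on [[0, T]]. A single
    entry is taken because the mean value inequality is for real functions. *)
Lemma absolutely_continuous_expmx_mul {R : realType} (n : nat) (M : 'M[R]_n)
    (z : R -> 'cV[R]_n) (T : R) i :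
  absolutely_continuous 0 T z ->
  absolutely_continuous 0 T
    (fun r => (expmx ((T - r) *: M) *m z r) i 0).
Proof.
move=> acz.
have [K K0 hK] := expmx_bounded M T.
have [K' K'0 hK'] := expmx_lipschitz M T.
have [Z Z0 hZ] := absolutely_continuous_bounded acz.
have acE : absolutely_continuous 0 T (fun r : R => expmx ((T - r) *: M)).
  apply: (lipschitz_absolutely_continuous K'0) => s t s0 st tT.
  have := hK' (T - t) (T - s); rewrite distrC.
  have -> : T - s - (T - t) = t - s by ring.
  by apply; lra.
have nKZ0 : 0 <= n%:R * (K + Z) by rewrite mulr_ge0// addr_ge0.
apply: (absolutely_continuous_dominated nKZ0 acE acz) => s t s0 st tT.
set Es := expmx ((T - s) *: M); set Et := expmx ((T - t) *: M).
have -> : (Et *m z t) i 0 - (Es *m z s) i 0 =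
    (Et *m (z t - z s) + (Et - Es) *m z s) i 0.
  by rewrite mulmxBr mulmxBl addrA subrK !mxE.
apply: le_trans (mx_norm_entry _ _ _) _; apply: le_trans (ler_normD _ _) _.
have h1 := mx_norm_mul Et (z t - z s); have h2 := mx_norm_mul (Et - Es) (z s).
have h3 : `|Et| <= K by apply: hK; apply/andP; split; lra.
have h4 : `|z s| <= Z by apply: hZ; rewrite s0 (le_trans st).
apply: le_trans (lerD h1 h2) _.
rewrite -!mulrA -mulrDr ler_wpM2l// mulrDr !mulrDl.
have := ler_wpM2r (normr_ge0 (z t - z s)) h3.
have := ler_wpM2l (normr_ge0 (Et - Es)) h4.
have := mulr_ge0 K0 (normr_ge0 (Et - Es)).
have := mulr_ge0 Z0 (normr_ge0 (z t - z s)).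
lra.
Qed.

(** [f] is compared with [M z + h] along [z] alone, so [h] may be built from another trajectory of a
    coupled system. *)
Lemma ode_solution_perturbed_decay {R : realType} (n : nat) (M : 'M[R]_n)
    (f : R -> 'cV[R]_n -> 'cV[R]_n) (z h : R -> 'cV[R]_n) :
  stable M -> ode_solution f z ->
  (forall t, 0 < t -> f t (z t) = M *m z t + h t) ->
  cvg0_exponentially h -> cvg0_exponentially z.
Proof.
move=> /stable_expmx_decay[c [g1 [g10 hE]]] [acz dz] fE [b [g2 [g20 hb]]].
pose g := Num.min g1 g2; have g0 : 0 < g by rewrite lt_min g10.
have decay_le k s (g' : R) : 0 <= s -> 0 <= k -> g <= g' ->
    k * expR (- (g' * s)) <= k * expR (- (g * s)).
  by move=> s0 k0 gg'; rewrite ler_wpM2l// ler_expR lerN2 ler_wpM2r.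
have c0 : 0 <= c.
  have := le_trans (normr_ge0 _) (hE 0 (lexx _)).
  by rewrite mulr0 oppr0 expR0 mulr1.
have b0 : 0 <= b.
  have := le_trans (normr_ge0 _) (hb 0 (lexx _)).
  by rewrite mulr0 oppr0 expR0 mulr1.
have gg1 : g <= g1 by rewrite ge_min lexx.
have gg2 : g <= g2 by rewrite ge_min lexx orbT.
have {}hE t : 0 <= t -> `|expmx (t *: M)| <= c * expR (- (g * t)).
  by move=> t0; apply: le_trans (hE t t0) _; exact: decay_le.
have {}hb t : 0 <= t -> `|h t| <= b * expR (- (g * t)).
  by move=> t0; apply: le_trans (hb t t0) _; exact: decay_le.
pose w t i (r : R) := (expmx ((t - r) *: M) *m z r) i 0.
have w0 t i : 0 <= t -> `|w t i 0| <= n%:R * (c * `|z 0|) * expR (- (g * t)).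
  move=> t0; rewrite /w subr0.
  apply: le_trans (mx_norm_entry _ _ _) _; apply: le_trans (mx_norm_mul _ _) _.
  rewrite [leRHS](_ : _ = n%:R * (c * expR (- (g * t))) * `|z 0|); last by ring.
  by rewrite ler_wpM2r// ler_wpM2l// hE.
(* Bound for the derivative of [w t i]: in the product of [expR (- (g * (t - r)))] and
   [expR (- (g * r))] the variable [r] cancels. *)
pose C t := n%:R * (c * b) * expR (- (g * t)).
have C0 t : 0 <= C t by rewrite !mulr_ge0// expR_ge0.
have acw t i : 0 < t -> absolutely_continuous 0 t (w t i).
  by move=> t0; exact: absolutely_continuous_expmx_mul (acz t t0).
have incr t i : 0 < t -> `|w t i t - w t i 0| <= C t * (t - 0).
  move=> t0; apply: absolutely_continuous_le (ltW t0) (C0 t) (acw t i t0) _.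
  move: dz; apply: (@filterS _ _ (ae_lebesgue_filter R)) => r dz /andP[r0 rt].
  have {}dz := dz r0; rewrite fE// in dz.
  exists ((expmx ((t - r) *: M) *m h r) i 0).
    by apply: is_derive_expmx_mul => l; exact: is_derive_entry.
  apply: le_trans (mx_norm_entry _ _ _) _; apply: le_trans (mx_norm_mul _ _) _.
  rewrite /C -mulrA -mulrA ler_wpM2l//.
  have tr0 : 0 <= t - r by rewrite subr_ge0 ltW.
  apply: le_trans (ler_pM _ _ (hE _ tr0) (hb _ (ltW r0))) _ => //.
  rewrite mulrACA -expRD -mulrA.
  by rewrite -opprD -mulrDr subrK mulrA.
(* Half of the rate is given up to absorb the factor [t] of the mean value inequality, through
   [1 + x <= expR x] at [x = g / 2 * t]. *)
exists (n%:R * (c * `|z 0|) + n%:R * (c * b) * (2 / g)), (g / 2).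
split=> [|t t0]; first by rewrite divr_gt0.
have half_le : expR (- (g * t)) <= expR (- (g / 2 * t)).
  rewrite ler_expR lerN2 ler_wpM2r// ler_pdivrMr// ler_peMr ?(ltW g0)//.
  by rewrite ler1n.
have t_le : t * expR (- (g * t)) <= 2 / g * expR (- (g / 2 * t)).
  rewrite (_ : - (g * t) = - (g / 2 * t) + - (g / 2 * t)); last by field.
  rewrite expRD mulrA ler_wpM2r ?expR_ge0//.
  rewrite expRN ler_pdivrMr ?expR_gt0//.
  have := expR_ge1Dx (g / 2 * t) => ht.
  rewrite -[leLHS](_ : 2 / g * (g / 2 * t) = t); last first.
    by field; rewrite gt_eqF.
  rewrite ler_wpM2l ?divr_ge0 ?(ltW g0)//; lra.
apply: mx_norm_le => [|i j].
  by rewrite mulr_ge0 ?expR_ge0// addr_ge0// !mulr_ge0// invr_ge0 ltW.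
rewrite [j]ord1.
have wt : `|w t i t - w t i 0| <= C t * t.
  have [->|t1] := eqVneq t 0; first by rewrite subrr normr0 mulr0.
  by rewrite -[X in _ * X]subr0; apply: incr; rewrite lt_neqAle eq_sym t1.
have wtt : w t i t = z t i 0 by rewrite /w subrr expmx0 mul1mx.
have := ler_normD (w t i t - w t i 0) (w t i 0); rewrite subrK wtt.
move/le_trans; apply; rewrite mulrDl addrC; apply: lerD.
  by apply: le_trans (w0 t i t0) _; rewrite ler_wpM2l// mulr_ge0// mulr_ge0.
rewrite -wtt; apply: le_trans wt _.
by rewrite /C -mulrA -[leRHS]mulrA ler_wpM2l ?mulr_ge0// mulrC.
Qed.

(** The right-hand sides are compared along the two solutions, so that a common input can drop out;
    the two exceptional null sets are merged. *)
Lemma ode_solutionB {R : realType} (n : nat)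
    (f g h : R -> 'cV[R]_n -> 'cV[R]_n) (x y : R -> 'cV[R]_n) :
  (forall t, f t (x t) - g t (y t) = h t (x t - y t)) ->
  ode_solution f x -> ode_solution g y ->
  ode_solution h (fun t => x t - y t).
Proof.
move=> fgh [acx dx] [acy dy]; split.
  move=> T T0.
  apply: absolutely_continuous_dominated ler01 (acx T T0) (acy T T0) _.
  move=> s t _ _ _.
  rewrite mul1r (_ : _ - _ = (x t - x s) - (y t - y s)); first exact: ler_normB.
  by rewrite !opprD !opprK addrACA.
apply: (@filterS2 _ _ (ae_lebesgue_filter R) _ _ _ _ dx dy) => t {}dx {}dy t0.
by rewrite -fgh; exact: is_deriveB (dx t0) (dy t0).
Qed.

Theorem theorem6p1 (R : realType) (n m p : nat)
    (A : 'M[R]_n) (B : 'M[R]_(n, p)) (C : 'M[R]_(m, n))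
    (hdet : detectable A C)
    (L : 'M[R]_(n, m)) (hL : stable (A + L *m C)) :
  dynamical_observer A B C L /\
  (stabilizable A B ->
   forall K : 'M[R]_(p, n), stable (A + B *m K) ->
   forall x xhat : R -> 'cV[R]_n,
     control_system A B (fun t => K *m xhat t) x ->
     observer_system A B C L (fun t => K *m xhat t) (fun t => C *m x t) xhat ->
     cvg0_exponentially x).
Proof.
have obs : dynamical_observer A B C L.
  move=> u x xhat hx hxhat.
  (* The terms [B *m u t] cancel, and [L *m (C *m x t)] joins [A *m x t]. *)
  have err : ode_solution (fun _ w => (A + L *m C) *m w)
      (fun t => xhat t - x t).
    apply: ode_solutionB hxhat hx => t.
    rewrite opprD addrACA subrr addr0 mulmxBr [in RHS](mulmxDl A _ (x t)).
    by rewrite -(mulmxA L C) opprD addrAC addrA.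
  apply: (ode_solution_perturbed_decay (h := fun=> 0) hL err) => [t _|].
    by rewrite addr0.
  by exists 0, 1; split=> // t _; rewrite normr0 mul0r.
split=> // _ K hK x xhat hx hxhat.
have [c [g [g0 he]]] := obs _ _ _ hx hxhat.
(* The control is [K *m x t] plus [K] times the error, whose decay was just obtained. *)
apply: (ode_solution_perturbed_decay (h := fun t => B *m K *m (xhat t - x t))
  hK hx) => [t _|].
  by rewrite mulmxDl -addrA -mulmxDr subrKC mulmxA.
exists (n%:R * `|B *m K| * c), g; split=> // t t0.
apply: le_trans (mx_norm_mul _ _) _.
by rewrite -[leRHS]mulrA ler_wpM2l ?mulr_ge0// he.
Qed.
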